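(* Let $r$ be a power of $2$. For each odd integer $n>0$ let $A_n\in t\,\mathbb{Z}/2[t^2]$, and suppose that for all odd $n>0$ \[ A_{n+8r}=t^{8r}A_n+t^{2r}A_{n+2r}. \] Say that $A_n$ satisfies condition $(1\alpha)$ if, writing $t^n=[a,b]$: when $a>0$, $A_n=[a-1,b]+$ a sum of monomials preceding $[a-1,b]$; when $a=0$, $A_n$ is a sum of monomials each equal to or preceding $[0,b-1]$. If $A_n$ satisfies $(1\alpha)$ for every odd $n<8r^2$, then $A_n$ satisfies $(1\alpha)$ for every odd $n>0$.
   Context: $\mathbb{N}=\{0,1,2,\dots\}$. Let $g:\mathbb{N}\to\mathbb{N}$ be defined by $g(0)=0$, $g(2n)=4g(n)$, $g(2n+1)=g(2n)+1$ (so if $n$ is a sum of distinct powers $q$ of $2$, $g(n)$ is the sum of the $q^2$). For $a,b\in\mathbb{N}$, $[a,b]$ denotes the monomial $t^{1+2g(a)+4g(b)}\in\mathbb{Z}/2[t]$; $(a,b)\mapsto[a,b]$ is a bijection from $\mathbb{N}\times\mathbb{N}$ onto the monomials $t^k$, $k$ odd and positive. Say $[c,d]$ precedes (is earlier than) $[a,b]$ if $c+d<a+b$, or $c+d=a+b$ and $d<b$. ''A sum of monomials'' with some property means a finite sum (possibly empty, i.e. $0$) of distinct monomials with that property. When $b=0$, no monomial is ''equal to or preceding $[0,b-1]$'', so the condition then means $A_n=0$. *)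

(* Defs.v *)
From HB Require Import structures.
From mathcomp Require Import all_boot all_order all_algebra.
From mathcomp Require Import zify.

Set Implicit Arguments.
Unset Strict Implicit.
Unset Printing Implicit Defensive.

Import GRing.Theory.
Local Open Scope ring_scope.

(* The first argument is fuel; fuel [n] suffices for input [n]. *)
Fixpoint g_rec (k n : nat) : nat :=
  (if k is k'.+1 then 4 * g_rec k' n./2 + odd n else 0)%N.

Definition g (n : nat) : nat := g_rec n n.

Lemma g_rec_fuel (k n : nat) : (n <= k)%N -> g_rec k n = g n.
Proof.
rewrite /g; elim/ltn_ind: k n => k IH n le_nk.
have z j : g_rec j 0 = 0%N by elim: j => //= j ->.
case: n le_nk => [|n] le_nk; first by rewrite !z.
case: k IH le_nk => [|k] IH le_nk //.
rewrite [LHS]/= [RHS]/=; congr (4 * _ + _)%N.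
have h : (uphalf n <= n)%N by lia.
case: (ltnP n k) => lt_nk; last by congr g_rec; lia.
by rewrite IH ?[RHS]IH //; lia.
Qed.

Lemma g0 : g 0 = 0%N.
Proof. by []. Qed.

Lemma gE (n : nat) : g n = (4 * g n./2 + odd n)%N.
Proof.
case: n => [|n] //.
have h : (n.+1./2 <= n)%N by lia.
by rewrite -(g_rec_fuel h).
Qed.

Lemma g_double (n : nat) : g (2 * n) = (4 * g n)%N.
Proof. by rewrite gE mul2n doubleK odd_double addn0. Qed.

Lemma g_doubleS (n : nat) : g (2 * n + 1) = (g (2 * n) + 1)%N.
Proof.
rewrite g_double gE.
by have [-> ->] : ((2 * n + 1)./2 = n /\ odd (2 * n + 1)) by lia.
Qed.

Definition mon_exp (p : nat * nat) : nat := (1 + 2 * g p.1 + 4 * g p.2)%N.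

Lemma mon_exp_inj : injective mon_exp.
Proof.
suff H a b c d : (g a + 2 * g b = g c + 2 * g d -> a = c /\ b = d)%N.
  move=> [a b] [c d]; rewrite /mon_exp /= => e.
  by have [-> ->] : a = c /\ b = d by apply: H; lia.
have [N] := ubnP (a + b + c + d).
elim: N a b c d => // N IH a b c d lt_N.
rewrite (gE a) (gE b) (gE c) (gE d) => e.
have [z|nz] := eqVneq (a + b + c + d)%N 0%N; first by lia.
have [] := IH a./2 b./2 c./2 d./2; lia.
Qed.

Lemma mon_exp_surj (n : nat) : odd n -> exists p, mon_exp p = n.
Proof.
suff [[a b] /= H] : exists p, (g p.1 + 2 * g p.2 = n./2)%N.
  by exists (a, b); rewrite /mon_exp /=; lia.
elim/ltn_ind: {n}(n./2) => m IH.
have [->|nz] := eqVneq m 0%N; first by exists (0, 0)%N.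
have [|[a b] /= H] := IH (m %/ 4)%N; first by lia.
exists (a.*2 + odd m, b.*2 + odd m./2)%N => /=.
have E x (e : bool) : g (x.*2 + e) = (4 * g x + e)%N.
  by rewrite gE; have [-> ->] : (x.*2 + e)./2 = x /\ odd (x.*2 + e) = e by lia.
by rewrite !E; lia.
Qed.

(* [mon (a, b)] is the monomial written [a, b]. *)
Definition mon (p : nat * nat) : {poly 'F_2} := 'X^(mon_exp p).

(* [precedes p q]: the monomial [mon p] is strictly earlier than [mon q]. *)
Definition precedes (p q : nat * nat) : bool :=
  ((p.1 + p.2 < q.1 + q.2) || (p.1 + p.2 == q.1 + q.2) && (p.2 < q.2))%N.

(* Distinctness of pairs is distinctness of monomials, by [mon_exp_inj]. *)
Definition sum_of_monomials (P : pred (nat * nat)) (f : {poly 'F_2}) : Prop :=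
  exists s : seq (nat * nat), [/\ uniq s, all P s & f = \sum_(p <- s) mon p].

(* Membership in t Z/2[t^2]. *)
Definition in_tF2t2 (f : {poly 'F_2}) : Prop :=
  exists q : {poly 'F_2}, f = 'X * (q \Po 'X^2).

(* For odd [n] exactly one pair (a, b) satisfies the premise, by            *)
(* [mon_exp_inj] and [mon_exp_surj].                                        *)
Definition cond1alpha (n : nat) (f : {poly 'F_2}) : Prop :=
  forall a b : nat, 'X^n = mon (a, b) ->
  match a, b with
  | a'.+1, _ => exists h : {poly 'F_2},
      sum_of_monomials (fun p => precedes p (a', b)) h /\ f = mon (a', b) + h
  | 0%N, b'.+1 =>
      sum_of_monomials (fun p => (p == (0%N, b')) || precedes p (0%N, b')) f
  | 0%N, 0%N => f = 0
  end.

(* Main.v *)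
Require Import Defs.
From HB Require Import structures.
From mathcomp Require Import all_boot all_order all_algebra.
From mathcomp Require Import zify.

Import GRing.Theory.
Local Open Scope ring_scope.

(**
  In characteristic 2 the recursion doubles: if it holds with [r] it also holds
  with [2r], hence with every [r * 2 ^ j]. On the other hand, when [Q] is a
  power of 2, multiplication by [t^(2Q^2)] sends [[c, d]] to [[c + Q, d]] if [Q]
  is not a binary digit of [c], and otherwise produces a carry, which makes the
  result strictly earlier than [[c + Q, d]]; similarly [t^(4Q^2)] sends
  [[c, d]] to [[c, d + Q]] or to something earlier. Given [t^n = [a, b]] with
  [n >= 8r^2], pick [Q >= r] with [2Q <= max(a, b) < 4Q]. If [a >= 2Q], apply
  the recursion with step [8Q^2], so that [A_n] is computed from the indices
  [[a - 2Q, b]] and [[a - 2Q, b] * t^(2Q^2)]; otherwise apply it with step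
  [16Q^2]. If [a > 0], exactly one of the two terms contributes the leading
  monomial [[a - 1, b]]: the second one when [a = 2Q], the first one otherwise,
  the second term then being made earlier by a carry.
*)

(** * Binary digits, [g], and carries *)

Definition bit (k n : nat) : bool := odd (n %/ 2 ^ k).

Lemma bitS k n : bit k.+1 n = bit k n./2.
Proof. by rewrite /bit expnS divnMA divn2. Qed.

Lemma bit_small k n : (n < 2 ^ k)%N -> bit k n = false.
Proof. by move=> lt_n; rewrite /bit divn_small. Qed.

Lemma bit_addn k n : bit k (n + 2 ^ k) = ~~ bit k n.
Proof.
by rewrite /bit -[X in (n + X)%N]mul1n divnDMl ?expn_gt0 // oddD /= addbT.
Qed.

Lemma bit_geq k n : bit k n -> (2 ^ k <= n)%N.
Proof. by rewrite leqNgt; apply: contraL => /bit_small ->. Qed.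

Lemma bit_subn k n : bit k n -> bit k (n - 2 ^ k) = false.
Proof.
move=> bn; have := bit_addn k (n - 2 ^ k); rewrite subnK ?bit_geq // bn.
by case: bit.
Qed.

Lemma g_addX k n : bit k n = false -> g (n + 2 ^ k) = (g n + 4 ^ k)%N.
Proof.
elim: k n => [|k IH] n.
  rewrite /bit expn0 divn1 => on; rewrite gE [in RHS]gE.
  by have [-> ->] : (n + 1)./2 = n./2 /\ odd (n + 1); lia.
rewrite bitS => /IH e; rewrite gE [in RHS]gE !expnS.
have [-> ->] : (n + 2 * 2 ^ k)./2 = (n./2 + 2 ^ k)%N
    /\ odd (n + 2 * 2 ^ k) = odd n by lia.
by rewrite e; lia.
Qed.

(** The extreme case has all digits 1, where [g n] is 1 + 4 + ... + 4^(k-1) = (4^k - 1)/3. The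
    factor 3 is what [mon_exp_ltn] needs, since 2 and 4 copies of this bound add up to 6. *)
Lemma g_ltn k n : (n < 2 ^ k)%N -> (3 * g n < 4 ^ k)%N.
Proof.
elim: k n => [|k IH] n; first by case: n.
rewrite !expnS => lt_n; have /IH : (n./2 < 2 ^ k)%N by lia.
by rewrite (gE n); lia.
Qed.

Lemma mon_exp_ltn k a b :
  (a < 2 ^ k -> b < 2 ^ k -> mon_exp (a, b) < 2 * 4 ^ k)%N.
Proof. by rewrite /mon_exp /= => /g_ltn ? /g_ltn ?; lia. Qed.

(** The digits of [c] and [d] interleave in the exponent, so this is binary addition: a carry from
    digit [k] of [c] goes to digit [k] of [d], and one from there to digit [k.+1] of [c]. Each half
    calls the other after a carry, hence the joint induction; a carry clears a digit, so [c + d]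
    drops. *)
Lemma mon_exp_add k c d :
  (exists c' d', mon_exp (c', d') = mon_exp (c, d) + 2 * 4 ^ k /\
     if bit k c then is_true (c' + d' <= c + d) else c' = c + 2 ^ k /\ d' = d)%N
  /\
  (exists c' d', mon_exp (c', d') = mon_exp (c, d) + 4 * 4 ^ k /\
     if bit k d then
       if bit k.+1 c then is_true (c' + d' + 2 ^ k <= c + d)
       else c' = c + 2 ^ k.+1 /\ d' = d - 2 ^ k
     else c' = c /\ d' = d + 2 ^ k)%N.
Proof.
have [N] := ubnP (c + d); elim: N k c d => // N IH k c d lt_N.
have k_gt0 : (0 < 2 ^ k)%N by rewrite expn_gt0.
split.
  case bc : (bit k c); last first.
    by exists (c + 2 ^ k)%N, d; rewrite /mon_exp /= g_addX //; lia.
  have le_c := bit_geq _ _ bc.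
  have gc := g_addX _ _ (bit_subn _ _ bc); rewrite subnK // in gc.
  have [|_ [c' [d' [e H]]]] := IH k (c - 2 ^ k)%N d; first by lia.
  exists c', d'; split; first by move: e; rewrite /mon_exp /=; lia.
  case bd : (bit k d) H; last by lia.
  by have := bit_geq _ _ bd; case: (bit k.+1 _); rewrite ?expnS; lia.
case bd : (bit k d); last first.
  by exists c, (d + 2 ^ k)%N; rewrite /mon_exp /= g_addX //; lia.
have le_d := bit_geq _ _ bd.
have gd := g_addX _ _ (bit_subn _ _ bd); rewrite subnK // in gd.
have [|[c' [d' [e H]]] _] := IH k.+1 c (d - 2 ^ k)%N; first by lia.
exists c', d'; split; first by move: e; rewrite /mon_exp /= expnS; lia.
by move: H; case: (bit k.+1 c); lia.
Qed.

(** * Spans of monomials in characteristic 2 *)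

Lemma addpp (f : {poly 'F_2}) : f + f = 0.
Proof. by apply: addrr_pchar2; rewrite pchar_poly; apply: pchar_Fp. Qed.

Lemma mulX_mon n p q :
  mon_exp q = (mon_exp p + n)%N -> 'X^n * mon p = mon q.
Proof. by rewrite /mon => ->; rewrite -exprD addnC. Qed.

(* Unlike in [sum_of_monomials], repetitions are allowed; in characteristic 2 *)
(* they cancel, so the two predicates agree.                                  *)
Definition mon_span (P : pred (nat * nat)) (f : {poly 'F_2}) : Prop :=
  exists2 s : seq (nat * nat), all P s & f = \sum_(p <- s) mon p.

Lemma mon_spanP P f : mon_span P f <-> sum_of_monomials P f.
Proof.
split=> [[s Ps ->]|[s [_ Ps ->]]]; last by exists s.
elim: s Ps => [|p s IH] /=; first by exists [::]; rewrite big_nil.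
case/andP=> Pp /IH [u [uniq_u Pu e]]; rewrite big_cons e.
have [p_u|p_u] := boolP (p \in u); last first.
  by exists (p :: u); rewrite /= p_u uniq_u Pp Pu big_cons.
exists (rem p u); split; first exact: rem_uniq.
  by apply/allP => q /mem_rem; apply: (allP Pu).
by rewrite (perm_big _ (perm_to_rem p_u)) /= big_cons addrA addpp add0r.
Qed.

Lemma mon_span0 P : mon_span P 0.
Proof. by exists [::]; rewrite ?big_nil. Qed.

Lemma mon_span_mon (P : pred (nat * nat)) p : P p -> mon_span P (mon p).
Proof. by move=> Pp; exists [:: p]; rewrite ?big_seq1 //= Pp. Qed.

Lemma mon_spanD P f h : mon_span P f -> mon_span P h -> mon_span P (f + h).
Proof.
by move=> [s Ps ->] [u Pu ->]; exists (s ++ u); rewrite ?all_cat ?Ps ?big_cat.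
Qed.

Lemma mon_spanW (P P' : pred (nat * nat)) f :
  (forall c d, P (c, d) -> P' (c, d)) -> mon_span P f -> mon_span P' f.
Proof. by move=> PP' [s Ps ->]; exists s => //; apply: sub_all Ps => -[]. Qed.

Lemma mon_span_mulX (P P' : pred (nat * nat)) n f :
  (forall c d, P (c, d) ->
     exists c' d', mon_exp (c', d') = (mon_exp (c, d) + n)%N /\ P' (c', d')) ->
  mon_span P f -> mon_span P' ('X^n * f).
Proof.
move=> PP' [s Ps ->]; elim: s Ps => [|[c d] s IH] /=.
  by rewrite big_nil mulr0 => _; apply: mon_span0.
case/andP=> /PP' [c' [d' [e Pc]]] /IH; rewrite big_cons mulrDr.
by apply: mon_spanD; rewrite (mulX_mon _ _ _ e); apply: mon_span_mon.
Qed.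

Notation prec q := (fun p => precedes p q).
Notation preceq q := (fun p => (p == q) || precedes p q).

(** * Multiplication by powers of t and the order on monomials *)

Lemma prec_mulX2 k a b f : mon_span (prec (a, b)) f ->
  mon_span (prec (a + 2 ^ k, b)%N) ('X^(2 * 4 ^ k) * f).
Proof.
apply: mon_span_mulX => c d.
have [[c' [d' [e H]]] _] := mon_exp_add k c d => cd; exists c', d'; split=> //.
have : (0 < 2 ^ k)%N by rewrite expn_gt0.
by move: cd H; rewrite /precedes /=; case: (bit k c); lia.
Qed.

Lemma preceq_mulX2 k a b f : mon_span (preceq (a, b)) f ->
  mon_span (preceq (a + 2 ^ k, b)%N) ('X^(2 * 4 ^ k) * f).
Proof.
apply: mon_span_mulX => c d.
have [[c' [d' [e H]]] _] := mon_exp_add k c d => cd; exists c', d'; split=> //.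
have : (0 < 2 ^ k)%N by rewrite expn_gt0.
by move: cd H; rewrite /precedes /= !xpair_eqE; case: (bit k c); lia.
Qed.

(** A single carry yields the same total as no carry would, but a smaller second coordinate; a
    second carry lowers the total. *)
Lemma prec_mulX4 k a b f : mon_span (prec (a, b)) f ->
  mon_span (prec (a, b + 2 ^ k)%N) ('X^(4 * 4 ^ k) * f).
Proof.
apply: mon_span_mulX => c d.
have [_ [c' [d' [e H]]]] := mon_exp_add k c d => cd; exists c', d'; split=> //.
have k_gt0 : (0 < 2 ^ k)%N by rewrite expn_gt0.
move: cd H; rewrite /precedes /= expnS.
case bd : (bit k d); last by lia.
by have := bit_geq _ _ bd; case: (bit k.+1 c); lia.
Qed.

Lemma preceq_mulX4 k a b f : mon_span (preceq (a, b)) f ->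
  mon_span (preceq (a, b + 2 ^ k)%N) ('X^(4 * 4 ^ k) * f).
Proof.
apply: mon_span_mulX => c d.
have [_ [c' [d' [e H]]]] := mon_exp_add k c d => cd; exists c', d'; split=> //.
have k_gt0 : (0 < 2 ^ k)%N by rewrite expn_gt0.
move: cd H; rewrite /precedes /= !xpair_eqE expnS.
case bd : (bit k d); last by lia.
by have := bit_geq _ _ bd; case: (bit k.+1 c); lia.
Qed.

Lemma total_mulX2 k m f : mon_span (fun p => p.1 + p.2 < m)%N f ->
  mon_span (fun p => p.1 + p.2 < m + 2 ^ k)%N ('X^(2 * 4 ^ k) * f).
Proof.
apply: mon_span_mulX => c d /= cd.
have [[c' [d' [e H]]] _] := mon_exp_add k c d; exists c', d'; split=> //=.
by move: H; case: (bit k c); lia.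
Qed.

(** * Condition (1α) in coordinates *)

Definition alpha (a b : nat) (f : {poly 'F_2}) : Prop :=
  match a, b with
  | a'.+1, _ => mon_span (prec (a', b)) (mon (a', b) + f)
  | 0%N, b'.+1 => mon_span (preceq (0%N, b')) f
  | 0%N, 0%N => f = 0
  end.

(** In characteristic 2 adding the leading monomial removes it, so the remainder [h] can be named
    explicitly; injectivity of [mon_exp] fixes the pair. *)
Lemma cond1alphaE a b f : cond1alpha (mon_exp (a, b)) f <-> alpha a b f.
Proof.
have addK q h : f = mon q + h <-> mon q + f = h.
  by split=> [->|<-]; rewrite addrA addpp add0r.
split=> [/(_ a b erefl)|H c d e].
  case: a => [|a]; last by case=> h [Ph /addK e]; apply/mon_spanP; rewrite e.
  by case: b => [|b] //; move/mon_spanP.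
have {e} [-> ->] : c = a /\ d = b.
  have : mon_exp (a, b) = mon_exp (c, d).
    have := congr1 (fun p : {poly 'F_2} => size p) e.
    by rewrite /mon !size_polyXn => /eqP; rewrite eqSS => /eqP.
  by move/mon_exp_inj => [-> ->].
case: a H => [|a] /=; last first.
  by move/mon_spanP => H; exists (mon (a, b) + f); split=> //; apply/addK.
by case: b => [|b] //; move/mon_spanP.
Qed.

Lemma alpha_preceq a b f : alpha a.+1 b f -> mon_span (preceq (a, b)) f.
Proof.
move=> /= H; rewrite -[f]add0r -(addpp (mon (a, b))) -addrA.
apply: mon_spanD; first by apply: mon_span_mon; rewrite eqxx.
by apply: mon_spanW H => c d ->; rewrite orbT.
Qed.

Lemma alpha_total a b f : alpha a b f ->
  mon_span (fun p => p.1 + p.2 < a + b)%N f.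
Proof.
case: a => [|a]; last first.
  move/alpha_preceq; apply: mon_spanW => c d.
  by rewrite /precedes !xpair_eqE /=; lia.
case: b => [|b] /=; first by move=> ->; apply: mon_span0.
by apply: mon_spanW => c d; rewrite /precedes !xpair_eqE /=; lia.
Qed.

(** * Passing the condition through one use of the recursion *)

Lemma bit_ltn k n : (n < 2 ^ k.+1)%N -> bit k n = false -> (n < 2 ^ k)%N.
Proof.
move=> lt_n bn; rewrite ltnNge; apply/negP => le_n.
have := bit_addn k (n - 2 ^ k); rewrite subnK // bn bit_small //.
by move: lt_n; rewrite expnS; lia.
Qed.

Lemma lead_mulX2 k a b f : bit k a = false ->
  mon_span (prec (a, b)) (mon (a, b) + f) ->
  mon_span (prec (a + 2 ^ k, b)%N) (mon (a + 2 ^ k, b)%N + 'X^(2 * 4 ^ k) * f).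
Proof.
move=> ba /prec_mulX2 - /(_ k); rewrite mulrDr (mulX_mon _ _ (a + 2 ^ k, b)%N) //.
by rewrite /mon_exp /= g_addX //; lia.
Qed.

Lemma lead_mulX4 k a b f : bit k b = false ->
  mon_span (prec (a, b)) (mon (a, b) + f) ->
  mon_span (prec (a, b + 2 ^ k)%N) (mon (a, b + 2 ^ k)%N + 'X^(4 * 4 ^ k) * f).
Proof.
move=> bb /prec_mulX4 - /(_ k); rewrite mulrDr (mulX_mon _ _ (a, b + 2 ^ k)%N) //.
by rewrite /mon_exp /= g_addX //; lia.
Qed.

(** Here [f0] and [f1] stand for the values of A at the exponents of [a, b] and [c, d]. With Q =
    2^k, the factor on [f0] has exponent 2(2Q)^2, which raises the first coordinate by 2Q. *)
Lemma alpha_step2 k a b c d f0 f1 :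
  (a < 2 ^ k.+1)%N -> mon_exp (c, d) = (mon_exp (a, b) + 2 * 4 ^ k)%N ->
  alpha a b f0 -> alpha c d f1 ->
  alpha (a + 2 ^ k.+1) b ('X^(8 * 4 ^ k) * f0 + 'X^(2 * 4 ^ k) * f1).
Proof.
have -> : (8 * 4 ^ k = 2 * 4 ^ k.+1)%N by rewrite expnS; lia.
have k_gt0 : (0 < 2 ^ k)%N by rewrite expn_gt0.
have Q2 : (2 ^ k.+1 = 2 * 2 ^ k)%N by rewrite expnS.
move=> lt_a e H0 H1.
have [[c' [d' [e' H]]] _] := mon_exp_add k a b.
have {e e'} [ec ed] : c' = c /\ d' = d.
  by move: e'; rewrite -e => /mon_exp_inj [].
subst c' d'.
case: a lt_a H0 H => [|a] lt_a H0.
  (* For [a = 0] the leading monomial comes from [f1]: [Q-1, b] moves to [2Q-1, b] without carry.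
     The [f0] term reaches at most [2Q, b-1], of the same total but earlier. *)
  rewrite bit_small // !add0n => -[ec ed]; rewrite {}ec {d}ed in H1.
  case E : (2 ^ k.+1)%N => [|m]; first by lia.
  rewrite /= [_ + 'X^_ * f1]addrC addrA; apply: mon_spanD.
    case E1 : (2 ^ k)%N H1 => [|q] H1; first by lia.
    have {H1}/(lead_mulX2 k) H1 : mon_span (prec (q, b)) (mon (q, b) + f1) by [].
    by have <- : (q + 2 ^ k = m)%N; [lia | apply: H1; apply: bit_small; lia].
  case: b H0 {H1} => [|b] /=; first by move=> ->; rewrite mulr0; apply: mon_span0.
  move/(preceq_mulX2 k.+1); apply: mon_spanW => c' d'.
  by rewrite /precedes xpair_eqE /=; lia.
rewrite addSn /= addrA => H; apply: mon_spanD.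
  by apply: lead_mulX2 => //; apply: bit_small; lia.
(* Now [f0] leads, and [f1] must only give earlier terms. If the index itself carried, its total did
   not grow, and bounding totals suffices. *)
case ba : (bit k a.+1) H => H.
  move/alpha_total/(total_mulX2 k): H1; apply: mon_spanW => c' d'.
  by rewrite /precedes /=; lia.
case: H => ec ed; rewrite {}ec {d}ed addSn /= in H1.
have lt_aQ := bit_ltn _ _ lt_a ba.
(* The leading monomial of [f1] is split off by adding it twice; its digit [k] is set, so
   multiplying it carries and it becomes earlier. *)
rewrite -['X^_ * f1]add0r -(addpp ('X^(2 * 4 ^ k) * mon (a + 2 ^ k, b)%N)) -addrA -mulrDr.
apply: mon_spanD; last first.
  move/(prec_mulX2 k): H1; apply: mon_spanW => c' d'.
  by rewrite /precedes /=; lia.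
have [[c' [d' [e' H]]] _] := mon_exp_add k (a + 2 ^ k) b.
rewrite (mulX_mon _ _ _ e'); apply: mon_span_mon.
by move: H; rewrite bit_addn bit_small /precedes /=; lia.
Qed.

Lemma alpha_step4 k a b c d f0 f1 :
  (a < 2 ^ k.+1)%N -> (b < 2 ^ k.+1)%N ->
  mon_exp (c, d) = (mon_exp (a, b) + 4 * 4 ^ k)%N ->
  alpha a b f0 -> alpha c d f1 ->
  alpha a (b + 2 ^ k.+1) ('X^(16 * 4 ^ k) * f0 + 'X^(4 * 4 ^ k) * f1).
Proof.
have -> : (16 * 4 ^ k = 4 * 4 ^ k.+1)%N by rewrite expnS; lia.
have k_gt0 : (0 < 2 ^ k)%N by rewrite expn_gt0.
have Q2 : (2 ^ k.+1 = 2 * 2 ^ k)%N by rewrite expnS.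
move=> lt_a lt_b e H0 H1.
have [_ [c' [d' [e' H]]]] := mon_exp_add k a b.
have {e e'} [ec ed] : c' = c /\ d' = d.
  by move: e'; rewrite -e => /mon_exp_inj [].
subst c' d'.
rewrite (bit_small k.+1 a) // in H.
case: a lt_a H0 H => [|a] lt_a H0 H.
  case E : (b + 2 ^ k.+1)%N => [|m]; first by lia.
  apply: mon_spanD.
    case: b H0 E {H lt_b} => [|b] /= H0 E; first by rewrite H0 mulr0; apply: mon_span0.
    by have <- : (b + 2 ^ k.+1 = m)%N; [lia | apply: preceq_mulX4].
  (* With Q = 2^k, a carry makes the index [2Q, b-Q], so [f1] reaches at most [2Q-1, b], which has
     the total of [0, b+2Q-1]. *)
  case bb : (bit k b) H => -[ec ed]; rewrite {}ec {d}ed ?add0n in H1.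
    have le_b := bit_geq _ _ bb.
    case E1 : (2 ^ k.+1)%N H1 => [|q] H1; first by lia.
    move/alpha_preceq/(preceq_mulX4 k): H1; apply: mon_spanW => c' d'.
    by rewrite /precedes !xpair_eqE /=; lia.
  case E1 : (b + 2 ^ k)%N H1 => [|q] H1; first by lia.
  by have <- : (q + 2 ^ k = m)%N; [lia | apply: preceq_mulX4].
rewrite /= addrA; apply: mon_spanD.
  by apply: lead_mulX4 => //; apply: bit_small.
case bb : (bit k b) H => -[ec ed]; rewrite {}ec {d}ed ?addSn in H1.
  have le_b := bit_geq _ _ bb.
  move/alpha_preceq/(preceq_mulX4 k): H1; apply: mon_spanW => c' d'.
  by rewrite /precedes !xpair_eqE /=; lia.
have lt_bQ := bit_ltn _ _ lt_b bb; move: H1 => /= H1.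
rewrite -['X^_ * f1]add0r -(addpp ('X^(4 * 4 ^ k) * mon (a, b + 2 ^ k)%N)) -addrA -mulrDr.
apply: mon_spanD; last first.
  move/(prec_mulX4 k): H1; apply: mon_spanW => c' d'.
  by rewrite /precedes /=; lia.
(* Digit [k] of [b + 2 ^ k] is set and digit [k.+1] of [a] is not, so the product is [a+2Q, b], with
   Q = 2^k: same total as [a, b+2Q], smaller second coordinate. *)
have [_ [c' [d' [e' H]]]] := mon_exp_add k a (b + 2 ^ k).
rewrite (mulX_mon _ _ _ e'); apply: mon_span_mon.
move: H; rewrite bit_addn bb /= bit_small; last by lia.
by rewrite /precedes /=; lia.
Qed.

(** * Doubling the step of the recursion, then induction on the exponent *)

Lemma recursion_mul2X (r : nat) (A : nat -> {poly 'F_2}) :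
  (forall n : nat, odd n ->
     A (n + 8 * r)%N = 'X^(8 * r) * A n + 'X^(2 * r) * A (n + 2 * r)%N) ->
  forall j n : nat, odd n -> let R := (r * 2 ^ j)%N in
     A (n + 8 * R)%N = 'X^(8 * R) * A n + 'X^(2 * R) * A (n + 2 * R)%N.
Proof.
move=> hrec; elim=> [|j IH] n on; first by rewrite /= expn0 muln1; apply: hrec.
rewrite expnS /=; move: (IH) => /=; set R := (r * 2 ^ j)%N => {}IH.
have -> : (r * (2 * 2 ^ j) = 2 * R)%N by rewrite /R; lia.
have -> : (n + 8 * (2 * R) = n + 8 * R + 8 * R)%N by lia.
rewrite IH ?IH; try by lia.
have -> : (n + 8 * R + 2 * R = n + 2 * R + 8 * R)%N by lia.
rewrite IH; last by lia.
have -> : (n + 2 * R + 2 * R = n + 2 * (2 * R))%N by lia.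
(* The expansions at n+8R and n+10R each contribute t^(10R) A_(n+2R); these cancel. *)
rewrite !mulrDr !mulrA -!exprD addrA [(2 * R + 8 * R)%N]addnC.
rewrite -[X in X + _]addrA addpp addr0.
by congr ('X^_ * _ + 'X^_ * _); lia.
Qed.

Theorem theorem3p7 (r : nat) (A : nat -> {poly 'F_2})
  (hr : exists m : nat, r = (2 ^ m)%N)
  (hA : forall n : nat, odd n -> in_tF2t2 (A n))
  (hrec : forall n : nat, odd n ->
     A (n + 8 * r)%N = 'X^(8 * r) * A n + 'X^(2 * r) * A (n + 2 * r)%N)
  (hinit : forall n : nat, odd n -> (n < 8 * r ^ 2)%N -> cond1alpha n (A n)) :
  forall n : nat, odd n -> cond1alpha n (A n).
Proof.
elim/ltn_ind=> n IH on.
have [lt_n|le_n] := ltnP n (8 * r ^ 2); first exact: hinit.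
have {IH} IH c d : (mon_exp (c, d) < n)%N -> alpha c d (A (mon_exp (c, d))).
  by move=> lt_cd; apply/cond1alphaE; apply: IH => //; rewrite /mon_exp /=; lia.
have {hrec} rec j m : odd m -> (r <= 2 ^ j)%N ->
    A (m + 8 * 2 ^ j)%N
    = 'X^(8 * 2 ^ j) * A m + 'X^(2 * 2 ^ j) * A (m + 2 * 2 ^ j)%N.
  case: hr hrec => i -> /recursion_mul2X - /(_ (j - i)%N m) H om.
  by rewrite leq_exp2l // => le_ij; move: H; rewrite -expnD subnKC //; apply.
have [[a b] en] := mon_exp_surj on.
rewrite -{}en in on le_n IH *; apply/cond1alphaE.
have [k [le_rk ab_gek ab_ltk]] : exists k, [/\ r <= 2 ^ k, 2 ^ k.+1 <= maxn a b
    & maxn a b < 2 ^ k.+2]%N.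
  case: hr le_n => i -> le_n.
  (* If both coordinates were below 2r, the exponent would be below 2(2r)^2 = 8r^2. *)
  have le_i : (2 ^ i.+1 <= maxn a b)%N.
    rewrite leqNgt; apply/negP; rewrite gtn_max => /andP [/mon_exp_ltn H /H].
    have Ei : ((2 ^ i) ^ 2 = 4 ^ i)%N by rewrite -expnM mulnC expnM.
    by move: le_n; rewrite Ei expnS; lia.
  have lt_il : (i < trunc_log 2 (maxn a b))%N by apply: trunc_log_max.
  have ab_gt0 : (0 < maxn a b)%N by apply: leq_trans le_i; rewrite expn_gt0.
  have /andP [H1 H2] := trunc_log_bounds (isT : 1 < 2)%N ab_gt0.
  exists (trunc_log 2 (maxn a b)).-1; rewrite leq_exp2l //.
  by rewrite (ltn_predK lt_il); split=> //; lia.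
have Q2 : (2 ^ k.+2 = 2 * 2 ^ k.+1)%N by rewrite expnS.
have k_gt0 : (0 < 4 ^ k)%N by rewrite expn_gt0.
(* [rec] takes its step as a power of 2; the steps used are Q^2 and 2Q^2 for Q = 2^k. *)
have E4 : (4 ^ k = 2 ^ (k + k))%N by rewrite addnn -mul2n expnM.
have le_r4 : (r <= 4 ^ k)%N.
  by apply: leq_trans le_rk _; rewrite E4 leq_exp2l // leq_addr.
have [le_a|lt_a] := leqP (2 ^ k.+1) a.
  have lt_a : (a - 2 ^ k.+1 < 2 ^ k.+1)%N by lia.
  have gea := g_addX _ _ (bit_small _ _ lt_a).
  rewrite subnK // in gea.
  have e0 : mon_exp (a, b) = (mon_exp (a - 2 ^ k.+1, b) + 8 * 4 ^ k)%N.
    by rewrite /mon_exp /= gea (expnS 4); lia.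
  have [[c [d [e _]]] _] := mon_exp_add k (a - 2 ^ k.+1) b.
  rewrite -{1}(subnK le_a) e0 E4 rec -?E4 // -?e; last by move: on; lia.
  by apply: (alpha_step2 _ _ _ c d) => //; apply: IH; lia.
have le_b : (2 ^ k.+1 <= b)%N by lia.
have lt_b : (b - 2 ^ k.+1 < 2 ^ k.+1)%N by lia.
have geb := g_addX _ _ (bit_small _ _ lt_b).
rewrite subnK // in geb.
have e0 : mon_exp (a, b) = (mon_exp (a, b - 2 ^ k.+1) + 8 * 2 ^ (k + k).+1)%N.
  by rewrite /mon_exp /= geb !expnS -E4; lia.
have [_ [c [d [e _]]]] := mon_exp_add k a (b - 2 ^ k.+1).
have E8 : (8 * 2 ^ (k + k).+1 = 16 * 4 ^ k)%N by rewrite expnS -E4; lia.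
have E2 : (2 * 2 ^ (k + k).+1 = 4 * 4 ^ k)%N by rewrite expnS -E4; lia.
rewrite -{1}(subnK le_b) e0 rec; last 2 first.
- by move: on; lia.
- by lia.
rewrite E2 E8 -e.
by apply: (alpha_step4 _ _ _ c d) => //; apply: IH; lia.
Qed.
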